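(* Let $d>0$ be an integer. (a) Every finite convex $P\subseteq\mathbb{N}^d$ that is not a chain satisfies $\pi(P)\ge |P|/2-1$. (b) There is a constant $C_d$ depending only on $d$ such that every finite ideal $P$ of $\mathbb{N}^d$ not contained in a coordinate hyperplane satisfies $\pi(P)>(1-1/d)|P|-C_d$.
   Context: $\mathbb{N}^d$ carries the product (coordinatewise) order, and subsets carry the induced order. $Q$ is convex if $x,z\in Q$ and $x<y<z$ imply $y\in Q$. An ideal (downset) of a poset $R$ is $I\subseteq R$ with $x<y\in I\Rightarrow x\in I$. For $x\in P$, $\pi(x)$ is the number of elements of $P$ incomparable to $x$ (neither $x<y$ nor $y<x$), and $\pi(P)=\max_{x\in P}\pi(x)$. *)

(* Defs.v *)
From mathcomp Require Import all_boot all_order all_algebra.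
From mathcomp Require Import finmap.

Set Implicit Arguments.
Unset Strict Implicit.
Unset Printing Implicit Defensive.

Import Order.TTheory.

Local Open Scope order_scope.

(* A plain tuple type carries the lexicographic order in MathComp;
   [tupleprod] carries the coordinatewise one. *)
Notation Nd d := (d.-tupleprod nat).

Definition chain (d : nat) (P : {fset Nd d}) : Prop :=
  {in P &, forall x y, x >=< y}.

Definition convex (d : nat) (P : {fset Nd d}) : Prop :=
  forall x y z : Nd d, x \in P -> z \in P -> x < y -> y < z -> y \in P.

Definition ideal (d : nat) (P : {fset Nd d}) : Prop :=
  forall x y : Nd d, y \in P -> x < y -> x \in P.

Definition in_coord_hyperplane (d : nat) (P : {fset Nd d}) : Prop :=
  exists i : 'I_d, {in P, forall x, tnth x i = 0%N}.

(* [x >< y] negates [(x <= y) || (y <= x)], so an element is never counted as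
   incomparable to itself. *)
Definition incomp (d : nat) (P : {fset Nd d}) (x : Nd d) : nat :=
  #|` [fset y in P | (x >< y)%O]%fset|.

Definition max_incomp (d : nat) (P : {fset Nd d}) : nat :=
  (\max_(x <- P) incomp P x)%N.

(* Main.v *)
Require Import Defs.
From mathcomp Require Import all_boot all_order all_algebra.
From mathcomp Require Import finmap.
From mathcomp Require Import zify lra.

(** Write comp(x) for the number of elements of P comparable to x, x included,
    so that pi(x) = |P| - comp(x).

    For (a), choose a coordinate i that is not constant on P.  Let x have the
    largest i-th coordinate and, among those, the smallest sum of the other
    coordinates; let y be extremal in the opposite sense.  By convexity, elements
    of P above x agree with x at i, those below x agree with x off i, and for y
    the two cases are exchanged.  If x and y are incomparable, an element
    comparable to both is then one of two determined points, so
    comp(x) + comp(y) <= |P| + 2.  If y <= x, the line through x and y in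
    direction i meets P in a chain closed under comparability; since P is not a
    chain there is w in P off this line, and comp(x) + comp(w) <= |P|.

    For (b), let n_j be the largest j-th coordinate in P and call j short when
    n_j + 1 < d.  For j short let F_j be the set of points whose short coordinates
    are those of e_j; for j long let F_j be the positive part of the j-th axis.
    These d sets are disjoint, so some F_j has at most |P|/d elements.  If j is
    short, a maximal element v >= e_j among the points supported on the short
    coordinates has boundedly many elements below it, and those above it inject
    into F_j.  If j is long, take x = n_j e_j: with t = n_j + 1 and q the number
    of points of P on the facet z_j = n_j, one has comp(x) <= t + q, tq <= |P| and
    d <= t <= |P|/d + 1, and (t - d)(q - d) >= 0 gives d(t + q) <= |P| + O(1). *)

Set Implicit Arguments.
Unset Strict Implicit.
Unset Printing Implicit Defensive.

Import Order.TTheory GRing.Theory Num.Theory.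

Local Open Scope ring_scope.

(** * Counting in finite sequences and choosing extremal elements *)

Lemma sum_count_disjoint (T : eqType) (I : finType) (F : I -> pred T) (s : seq T) :
    {in s, forall z i j, F i z -> F j z -> i = j} ->
  (\sum_i count (F i) s <= size s)%N.
Proof.
elim: s => [|z s IHs] disjF /=; first by rewrite big1.
rewrite big_split /= -add1n leq_add //; last first.
  by apply: IHs => y ys; apply: disjF; rewrite inE ys orbT.
case: (pickP (F^~ z)) => [i Fiz | noF]; last by rewrite big1 // => i _; rewrite noF.
rewrite (bigD1 i) //= Fiz big1 // => j ne_ji.
case Fjz: (F j z) => //.
by rewrite (disjF z (mem_head _ _) _ _ Fjz Fiz) eqxx in ne_ji.
Qed.

Lemma sub_in_count (T : eqType) (s : seq T) (F G : pred T) :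
  {in s, forall z, F z -> G z} -> (count F s <= count G s)%N.
Proof.
elim: s => //= z s IHs FG; apply: leq_add; last first.
  by apply: IHs => y ys; apply: FG; rewrite inE ys orbT.
by case Fz: (F z) => //; rewrite FG ?mem_head.
Qed.

Lemma leq_count_inj (T : eqType) (s : seq T) (F G : pred T) (f : T -> T) :
    uniq s -> {in s, forall z, F z -> f z \in s /\ G (f z)} ->
    {in F &, injective f} ->
  (count F s <= count G s)%N.
Proof.
move=> us FG finj; rewrite -!size_filter -(size_map f).
apply: uniq_leq_size.
  rewrite map_inj_in_uniq ?filter_uniq // => x y.
  by rewrite !mem_filter => /andP[Fx _] /andP[Fy _]; apply: finj.
move=> _ /mapP[z + ->]; rewrite !mem_filter => /andP[Fz zs].
by have [-> ->] := FG z zs Fz.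
Qed.

Lemma count_le_card (T : eqType) (J : finType) (s : seq T) (F : pred T)
    (f : T -> J) :
  uniq s -> {in [pred z in s | F z] &, injective f} -> (count F s <= #|J|)%N.
Proof.
move=> us finj; rewrite -size_filter -(size_map f) -(card_uniqP _).
  exact: max_card.
rewrite map_inj_in_uniq ?filter_uniq // => x y.
rewrite !mem_filter => /andP[Fx xs] /andP[Fy ys].
by apply: finj; rewrite inE /= ?xs ?ys.
Qed.

Lemma exists_counterexample (T : eqType) (s : seq T) (Q : pred T) :
  ~ {in s, forall z, Q z} -> exists2 z, z \in s & ~~ Q z.
Proof. by move=> nQ; apply/allPn; apply/negP => /allP. Qed.

Lemma eq_of_leq_sum (I : finType) (Q : pred I) (f g : I -> nat) :
    (forall k, Q k -> f k <= g k)%N ->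
    (\sum_(k | Q k) g k <= \sum_(k | Q k) f k)%N ->
  forall k, Q k -> f k = g k.
Proof.
move=> lefg le_sum k Qk; apply/eqP; rewrite eqn_leq lefg //=.
rewrite -(leq_add2r (\sum_(j | Q j && (j != k)) g j)%N).
rewrite (bigD1 k) //= [leqRHS](bigD1 k) //= in le_sum.
by apply: leq_trans le_sum _; rewrite leq_add2l leq_sum // => j /andP[/lefg].
Qed.

(** Integer keys let a maximum be taken as the minimum of a negated key; a constant second key gives
    a plain extremum. *)
Lemma exists_lexmin (T : eqType) (s : seq T) (a b : T -> int) (z0 : T) :
    z0 \in s ->
  exists2 x, x \in s & {in s, forall z, a x < a z \/ (a x = a z /\ b x <= b z)}.
Proof.
elim: s z0 => // z1 s IHs _ _; case: s IHs => [|z2 s] IHs.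
  by exists z1; rewrite ?mem_head // => z; rewrite inE => /eqP ->; right.
have [x xs minx] := IHs z2 (mem_head _ _).
have [lt1|[] lt1] : (a x < a z1 \/ (a x = a z1 /\ b x <= b z1)) \/
    (a z1 < a x \/ (a z1 = a x /\ b z1 <= b x)) by lia.
- by exists x => [|z /predU1P[->//|/minx//]]; rewrite inE xs orbT.
- exists z1; first exact: mem_head.
  by move=> z /predU1P[->|/minx]; [right | lia].
- exists z1; first exact: mem_head.
  by move=> z /predU1P[->|/minx]; [right | lia].
Qed.

(** * Coordinates and the count of comparable elements *)

Section Coordinates.
Context {d : nat}.
Implicit Types (x y z : Nd d) (P : {fset Nd d}).

Definition proj x (i : 'I_d) : nat := tnth x i.

Lemma le_coordP x y : reflect (forall i, (proj x i <= proj y i)%N) (x <= y)%O.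
Proof. by rewrite leEtprod; apply: forallP. Qed.

Lemma coord_inj x y : (forall i, proj x i = proj y i) -> x = y.
Proof. exact: eq_from_tnth. Qed.

Definition point (f : 'I_d -> nat) : Nd d := [tuple f i | i < d].

Lemma proj_point f i : proj (point f) i = f i.
Proof. exact: tnth_mktuple. Qed.

Definition agree (M : pred 'I_d) x z := [forall k, M k ==> (proj z k == proj x k)].

Lemma agreeP (M : pred 'I_d) x z :
  reflect (forall k, M k -> proj z k = proj x k) (agree M x z).
Proof.
apply: (iffP forallP) => [Az k Mk|Az k]; last by apply/implyP => /Az ->.
by apply/eqP; apply: (implyP (Az k)).
Qed.

Lemma incomp_count P x :
  (incomp P x + count (fun y => x >=< y)%O P = #|` P|%fset)%N.
Proof.
rewrite -(count_predC (fun y => x >=< y)%O) addnC; congr addn.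
rewrite /incomp -size_filter; apply: perm_size; apply: uniq_perm.
- exact: fset_uniq.
- exact/filter_uniq/fset_uniq.
- by move=> y; rewrite mem_filter !inE /= andbC.
Qed.

Lemma leq_max_incomp P x : x \in P -> (incomp P x <= max_incomp P)%N.
Proof. by move=> Px; apply: leq_bigmax_seq. Qed.

End Coordinates.

(** * Part (a): finite convex sets *)

Section Convex.
Context {d : nat}.
Implicit Types (x y z : Nd d) (P : {fset Nd d}).

Lemma convex_le P x y z :
  convex P -> x \in P -> z \in P -> (x <= y)%O -> (y <= z)%O -> y \in P.
Proof.
move=> cvxP Px Pz; rewrite le_eqVlt => /predU1P[<- //|ltxy].
by rewrite le_eqVlt => /predU1P[-> //|]; apply: cvxP ltxy.
Qed.

Definition sum_except (i : 'I_d) x : nat := (\sum_(k < d | k != i) proj x k)%N.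

Lemma sum_except_eq i x y : (x <= y)%O ->
  (sum_except i y <= sum_except i x)%N ->
  forall k, k != i -> proj x k = proj y k.
Proof.
by move=> /le_coordP lexy; apply: eq_of_leq_sum => k _; apply: lexy.
Qed.

Definition replace (i : 'I_d) x y : Nd d :=
  point (fun k => if k == i then proj x k else proj y k).

Definition max_then_min i P x := {in P, forall z,
  (proj z i < proj x i)%N \/
  proj z i = proj x i /\ (sum_except i x <= sum_except i z)%N}.

Definition min_then_max i P y := {in P, forall z,
  (proj y i < proj z i)%N \/
  proj z i = proj y i /\ (sum_except i z <= sum_except i y)%N}.

Lemma exists_max_then_min i P z0 : z0 \in P ->
  exists2 x, x \in P & max_then_min i P x.
Proof.
move=> /(exists_lexmin (fun z => - (proj z i)%:Z) (fun z => (sum_except i z)%:Z)).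
by move=> [x Px minx]; exists x => // z /minx /=; lia.
Qed.

Lemma exists_min_then_max i P z0 : z0 \in P ->
  exists2 y, y \in P & min_then_max i P y.
Proof.
move=> /(exists_lexmin (fun z => (proj z i)%:Z) (fun z => - (sum_except i z)%:Z)).
by move=> [x Px minx]; exists x => // z /minx /=; lia.
Qed.

Section Extremal.
Context {i : 'I_d} {P : {fset Nd d}} {x y : Nd d} (cvxP : convex P).
Hypotheses (Px : x \in P) (xmax : max_then_min i P x).
Hypotheses (Py : y \in P) (ymin : min_then_max i P y).

Lemma up_max z : z \in P -> (x <= z)%O -> proj z i = proj x i.
Proof. by move=> /xmax + /le_coordP /(_ i); lia. Qed.

Lemma down_min z : z \in P -> (z <= y)%O -> proj z i = proj y i.
Proof. by move=> /ymin + /le_coordP /(_ i); lia. Qed.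

(* Moving [z] into the extremal slice keeps it in [P], where it would have a
   smaller sum of the other coordinates than [x]. *)
Lemma down_max z : z \in P -> (z <= x)%O ->
  forall k, k != i -> proj z k = proj x k.
Proof.
move=> Pz lezx; have /le_coordP lec := lezx.
have lewx : (replace i x z <= x)%O.
  by apply/le_coordP => k; rewrite proj_point; case: eqP.
have Pw : replace i x z \in P.
  apply: convex_le Pz Px _ lewx => //.
  by apply/le_coordP => k; rewrite proj_point; case: eqP.
have [|[_ le_sum]] := xmax Pw; first by rewrite proj_point eqxx ltnn.
move=> k ne_ki; rewrite -(sum_except_eq lewx le_sum ne_ki) proj_point.
by rewrite (negbTE ne_ki).
Qed.

Lemma up_min z : z \in P -> (y <= z)%O ->
  forall k, k != i -> proj z k = proj y k.
Proof.
move=> Pz leyz; have /le_coordP lec := leyz.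
have leyw : (y <= replace i y z)%O.
  by apply/le_coordP => k; rewrite proj_point; case: eqP.
have Pw : replace i y z \in P.
  apply: convex_le Py Pz leyw _ => //.
  by apply/le_coordP => k; rewrite proj_point; case: eqP.
have [|[_ le_sum]] := ymin Pw; first by rewrite proj_point eqxx ltnn.
move=> k ne_ki; rewrite (sum_except_eq leyw le_sum ne_ki) proj_point.
by rewrite (negbTE ne_ki).
Qed.

(** Above both, [up_max] fixes coordinate [i] and [up_min] the others; below both, [down_min] and
    [down_max] do. Mixed positions would make [x] and [y] comparable. *)
Lemma common_comparable z : z \in P -> (x >< y)%O ->
  (z >=< x)%O -> (z >=< y)%O -> z = replace i x y \/ z = replace i y x.
Proof.
move=> Pz; rewrite /Order.comparable negb_or => /andP[nxy nyx].
move=> /orP[zx|xz] /orP[zy|yz].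
- right; apply: coord_inj => k; rewrite proj_point.
  by case: eqP => [->|/eqP ne_ki]; [exact: down_min | exact: down_max].
- by rewrite (le_trans yz zx) in nyx.
- by rewrite (le_trans xz zy) in nxy.
- left; apply: coord_inj => k; rewrite proj_point.
  by case: eqP => [->|/eqP ne_ki]; [exact: up_max | exact: up_min].
Qed.

(** The points of [P] on the line lie between [y] and [x], so anything comparable to one of them is
    below [x] or above [y], where [down_max] or [up_min] puts it on the line. *)
Lemma comparable_fibre r z : (y <= x)%O -> r \in P -> z \in P ->
    (forall k, k != i -> proj r k = proj x k) -> (z >=< r)%O ->
  forall k, k != i -> proj z k = proj x k.
Proof.
move=> leyx Pr Pz fib_r.
have fib_y := down_max Py leyx.
have ler_x : (r <= x)%O.
  apply/le_coordP => k; have [->|/fib_r -> //] := eqVneq k i.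
  by have := xmax Pr; lia.
have le_yr : (y <= r)%O.
  apply/le_coordP => k; have [->|ne_ki] := eqVneq k i.
    by have := ymin Pr; lia.
  by rewrite fib_y // fib_r.
move=> /orP[lezr|lerz]; first exact: down_max (le_trans lezr ler_x).
by move=> k ne_ki; rewrite (up_min Pz (le_trans le_yr lerz)) ?fib_y.
Qed.

End Extremal.

Lemma comparable_of_fibre i x y :
  (forall k, k != i -> proj x k = proj y k) -> (x >=< y)%O.
Proof.
move=> eqxy; apply/orP.
have [le|/ltnW le] := leqP (proj x i) (proj y i); [left | right];
  apply/le_coordP => k;
  by have [->|/eqxy ->] := eqVneq k i.
Qed.

Lemma max_incomp_ge P u v : u \in P -> v \in P ->
    (count (fun z => u >=< z)%O P + count (fun z => v >=< z)%O P
       <= #|` P|%fset + 2)%N ->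
  (#|` P|%fset <= (max_incomp P).*2 + 2)%N.
Proof.
move=> Pu Pv; have := leq_max_incomp Pu; have := leq_max_incomp Pv.
by have := incomp_count P u; have := incomp_count P v; lia.
Qed.

Lemma convex_max_incomp P : convex P -> ~ chain P ->
  (#|` P|%fset <= (max_incomp P).*2 + 2)%N.
Proof.
move=> cvxP nchainP.
have [u Pu [v Pv incuv]] : exists2 u, u \in P & exists2 v, v \in P & (u >< v)%O.
  have [u Pu] : exists2 u, u \in P & ~~ all (fun v => u >=< v)%O P.
    by apply: exists_counterexample => chP; apply: nchainP => u v /chP/allP; apply.
  by move=> /allPn[v Pv ncuv]; exists u => //; exists v.
have [i ne_uv] : exists i, proj u i != proj v i.
  apply/existsP; apply: contraR incuv; rewrite negb_exists => /forallP eqc.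
  suff -> : u = v by rewrite comparablexx.
  by apply: coord_inj => k; apply/eqP/negPn.
have [x Px xmax] := exists_max_then_min i Pu.
have [y Py ymin] := exists_min_then_max i Pu.
(* [u] and [v] differ at [i], so the extreme values at [i] are distinct. *)
have ltyx : (proj y i < proj x i)%N.
  have := xmax _ Pu; have := xmax _ Pv; have := ymin _ Pu; have := ymin _ Pv.
  by lia.
have nlexy : ~~ (x <= y)%O.
  by apply/negP => /le_coordP/(_ i); lia.
case: (boolP (y <= x)%O) => [leyx | nleyx].
  pose C := agree (predC1 i) x.
  have CP z : reflect (forall k, k != i -> proj z k = proj x k) (C z).
    exact: agreeP.
  have [w Pw nCw] : exists2 w, w \in P & ~~ C w.
    apply: exists_counterexample => allC; apply: (negP incuv).
    apply: (@comparable_of_fibre i) => k ne_ki.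
    by rewrite (CP _ (allC _ Pu)) // (CP _ (allC _ Pv)).
  (* Elements comparable to [x] lie on the line [C], those comparable to [w] off it. *)
  apply: (max_incomp_ge Px Pw); rewrite (leq_trans _ (leq_addr _ _)) //.
  rewrite -(count_predC C); apply: leq_add; apply: sub_in_count => z Pz /= cz.
    apply/CP; apply: (comparable_fibre cvxP Px xmax Py ymin leyx Px Pz) => //.
    by rewrite comparable_sym.
  apply: contra nCw => /CP Cz; apply/CP.
  exact: (comparable_fibre cvxP Px xmax Py ymin leyx Pz Pw).
(* The counts add up to that of the union, at most [|P|], plus that of the intersection, at most two
   points. *)
apply: (max_incomp_ge Px Py); rewrite -count_predUI.
apply: leq_add; first exact: count_size.
set a := replace i x y; set b := replace i y x.
apply: (@leq_trans (count (pred2 a b) P)).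
  apply: sub_in_count => z Pz /andP[xz yz].
  apply/pred2P; apply: (common_comparable cvxP Px xmax Py ymin Pz).
  - by rewrite negb_or nlexy.
  - by rewrite comparable_sym.
  - by rewrite comparable_sym.
have uP : uniq P := fset_uniq P.
rewrite -[leqRHS]/(1 + 1)%N.
apply: (@leq_trans (count (pred1 a) P + count (pred1 b) P)).
  by rewrite -count_predUI leq_addr.
by rewrite !count_uniq_mem // leq_add // leq_b1.
Qed.

End Convex.

(** * Part (b): finite ideals *)

Section Ideal.
Context {d : nat} {P : {fset Nd d}} (idP : ideal P).
Implicit Types x y z : Nd d.

Lemma ideal_le x y : y \in P -> (x <= y)%O -> x \in P.
Proof. by move=> Py; rewrite le_eqVlt => /predU1P[-> //|]; apply: idP. Qed.

(** Lowering the [M]-coordinates to those of [y] stays in the ideal and is injective on the fibre of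
    [x]. *)
Lemma leq_count_agree (M : pred 'I_d) x y :
    (forall k, M k -> proj y k <= proj x k)%N ->
  (count (agree M x) P <= count (agree M y) P)%N.
Proof.
move=> leyx; pose f z := point (fun k => if M k then proj y k else proj z k).
apply: (@leq_count_inj _ _ _ _ f); first exact: fset_uniq.
  move=> z Pz /agreeP Az; split; last first.
    by apply/agreeP => k Mk; rewrite proj_point Mk.
  apply: ideal_le Pz _; apply/le_coordP => k; rewrite proj_point.
  by case: ifP => // Mk; rewrite Az // leyx.
move=> z1 z2 /agreeP A1 /agreeP A2 eqf; apply: coord_inj => k.
have /(congr1 (fun z => proj z k)) := eqf; rewrite !proj_point.
by case: ifP => // Mk _; rewrite A1 ?A2.
Qed.

Definition axis (j : 'I_d) (m : nat) : Nd d :=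
  point (fun k => if k == j then m else 0%N).

Lemma axis_le j m z : (m <= proj z j)%N -> (axis j m <= z)%O.
Proof.
by move=> lemz; apply/le_coordP => k; rewrite proj_point; case: eqP => [->|].
Qed.

Definition side (j : 'I_d) : nat := \max_(z <- P) proj z j.

Lemma leq_side j z : z \in P -> (proj z j <= side j)%N.
Proof. by move=> Pz; rewrite /side (leq_bigmax_seq z). Qed.

(** [axis j 0] is the origin; its membership makes [P] nonempty, so the maximum [side j] is
    attained. *)
Lemma axis_side j : axis j 0 \in P -> axis j (side j) \in P.
Proof.
move=> /(exists_lexmin (fun z => - (proj z j)%:Z) (fun=> 0%:Z))[z Pz zmax].
apply: ideal_le Pz _; apply: axis_le; apply/bigmax_leqP_seq => w Pw _.
by have /= := zmax w Pw; lia.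
Qed.

Lemma count_comparable x :
  (count (fun z => x >=< z)%O P <=
   count (fun z => z <= x)%O P + count (fun z => x <= z)%O P)%N.
Proof.
rewrite -count_predUI; apply: leq_trans (leq_addr _ _).
by apply: sub_count => z /= /orP[->|->]; rewrite ?orbT.
Qed.


(** The slices at heights [0] to [side j] are disjoint, and by [leq_count_agree] none is smaller
    than the top one. *)
Lemma side_mul_facet j :
  ((side j).+1 * count (agree (pred1 j) (axis j (side j))) P <= #|` P|%fset)%N.
Proof.
apply: (@leq_trans (\sum_(m < (side j).+1) count (agree (pred1 j) (axis j m)) P)).
  rewrite -[X in (X * _)%N]card_ord -sum_nat_const leq_sum // => m _.
  apply: leq_count_agree => k /eqP ->.
  by rewrite !proj_point eqxx -ltnS.
apply: sum_count_disjoint => z _ m1 m2.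
move=> /agreeP/(_ j (eqxx j)) + /agreeP/(_ j (eqxx j)).
by rewrite !proj_point eqxx => -> /val_inj.
Qed.

(** Points below are determined by their [j]-th coordinate; points above lie on the top facet. *)
Lemma comparable_axis_side j : axis j 0 \in P ->
  (count (fun z => axis j (side j) >=< z)%O P <=
   (side j).+1 + count (agree (pred1 j) (axis j (side j))) P)%N.
Proof.
move=> P0; apply: leq_trans (count_comparable _) _; apply: leq_add.
  rewrite -[leqRHS]card_ord.
  apply: (@count_le_card _ _ _ _ (fun z => inord (proj z j))).
    exact: fset_uniq.
  move=> z1 z2 /andP[P1 /le_coordP le1] /andP[P2 /le_coordP le2].
  move=> /(congr1 val); rewrite /= !inordK ?ltnS ?leq_side // => eqj.
  apply: coord_inj => k; have [-> //|ne_kj] := eqVneq k j.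
  by have := le1 k; have := le2 k; rewrite proj_point (negbTE ne_kj); lia.
apply: sub_in_count => z Pz /le_coordP lez; apply/agreeP => k /eqP ->.
have := lez j; have := leq_side j Pz; rewrite !proj_point eqxx; lia.
Qed.

Section Short.
Variable M : pred 'I_d.

(** The sets [F_j], with [M] marking the short coordinates; positivity removes the origin, common to
    all axes. *)
Definition comb (j : 'I_d) : pred (Nd d) :=
  if M j then agree M (axis j 1)
  else fun z => (0 < proj z j)%N && (z == axis j (proj z j)).

(** Distinct short fibres disagree on [M]; a point of a long axis vanishes off that axis, while each
    set makes its own coordinate positive. *)
Lemma comb_disjoint z i j : comb i z -> comb j z -> i = j.
Proof.
have axis0 k1 k2 : k1 <> k2 -> z == axis k2 (proj z k2) -> proj z k1 = 0%N.
  by move=> /eqP ne /eqP ->; rewrite proj_point (negbTE ne).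
rewrite /comb; case: ifP => Mi; case: ifP => Mj.
- move=> /agreeP/(_ i Mi) zi /agreeP/(_ i Mi); rewrite {}zi !proj_point eqxx.
  by case: eqP.
- move=> /agreeP/(_ i Mi) + /andP[_ zj]; rewrite proj_point eqxx => zi.
  by case: (i =P j) => // /axis0/(_ zj); rewrite zi.
- move=> /andP[_ zi] /agreeP/(_ j Mj); rewrite proj_point eqxx => zj.
  by case: (i =P j) => // /nesym/axis0/(_ zi); rewrite zj.
- move=> /andP[_ zi] /andP[zj _].
  by case: (i =P j) => // /nesym/axis0/(_ zi) z0; rewrite z0 in zj.
Qed.

Lemma exists_small_comb : (0 < d)%N ->
  exists j, (d * count (comb j) P <= #|` P|%fset)%N.
Proof.
move=> d_gt0; apply/existsP; apply: contraT; rewrite negb_exists => /forallP big.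
have le_sum : (\sum_j count (comb j) P <= #|` P|%fset)%N.
  by apply: sum_count_disjoint => z _; apply: comb_disjoint.
have : (\sum_(j < d) #|` P|%fset.+1 <= \sum_(j < d) d * count (comb j) P)%N.
  by apply: leq_sum => j _; rewrite ltnNge big.
rewrite sum_nat_const card_ord -big_distrr /= leq_pmul2l // => /leq_trans/(_ le_sum).
by rewrite ltnn.
Qed.

Lemma side_le_comb j : axis j 0 \in P -> ~~ M j -> (side j <= count (comb j) P)%N.
Proof.
move=> P0 nMj; rewrite -[leqLHS](size_iota 1) -(size_map (axis j)) -size_filter.
apply: uniq_leq_size.
  rewrite map_inj_uniq ?iota_uniq // => m1 m2 /(congr1 (fun z => proj z j)).
  by rewrite !proj_point eqxx.
move=> _ /mapP[m + ->]; rewrite mem_iota mem_filter /comb (negbTE nMj).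
rewrite proj_point !eqxx /= andbT => /andP[-> lem] /=.
by apply: ideal_le (axis_side P0) _; apply: axis_le; rewrite proj_point eqxx; lia.
Qed.

(* A maximal [v] among the points of [P] supported on [M] and above the unit
   vector: every point above [v] lies in the [M]-fibre of [v], which is at most
   as large as that of the unit vector. *)
Lemma comparable_short j : M j -> axis j 1 \in P ->
    (forall k, M k -> side k <= d)%N ->
  exists2 v, v \in P &
    (count (fun z => v >=< z)%O P <= d.+1 ^ d + count (comb j) P)%N.
Proof.
move=> Mj Pj side_le; pose e := axis j 1.
pose supp w := [forall k, M k || (proj w k == 0%N)].
pose s := [seq w <- P | (e <= w)%O && supp w].
have es : e \in s.
  rewrite mem_filter lexx Pj andbT /=; apply/forallP => k; rewrite proj_point.
  by case: (k =P j) => [->|]; rewrite ?Mj ?eqxx ?orbT.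
have [v] := exists_lexmin (fun w => - (\sum_k proj w k)%N%:Z) (fun=> 0%:Z) es.
rewrite mem_filter => /andP[/andP[lev /forallP vM] Pv] vmax; exists v => //.
apply: leq_trans (count_comparable _) _; apply: leq_add.
  (* Points below [v] have coordinates at most [d], since [v] vanishes off [M]; they embed into
     functions from ['I_d] to ['I_d.+1]. *)
  rewrite -[X in (_ ^ X)%N](card_ord d) -[X in (X ^ _)%N]card_ord -card_ffun.
  apply: (@count_le_card _ _ _ _ (fun z => [ffun k => inord (proj z k)])).
    exact: fset_uniq.
  have bound z k : (z <= v)%O -> (proj z k < d.+1)%N.
    move=> /le_coordP/(_ k) lezv; rewrite ltnS (leq_trans lezv) //.
    case/orP: (vM k) => [Mk|/eqP -> //].
    by apply: leq_trans (side_le k Mk); apply: leq_side.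
  move=> z1 z2 /andP[P1 le1] /andP[P2 le2] /ffunP eqf; apply: coord_inj => k.
  by have := congr1 val (eqf k); rewrite !ffunE /= !inordK ?bound.
apply: (@leq_trans (count (agree M v) P)); last first.
  rewrite /comb Mj; apply: leq_count_agree => k Mk.
  by move/le_coordP: lev; apply.
apply: sub_in_count => z Pz levz; apply/agreeP => k Mk.
(* Clearing [z] off [M] gives a point of [s] above [v]; maximality of the coordinate sum of [v]
   forces equality. *)
pose w := point (fun k => if M k then proj z k else 0%N).
have levw : (v <= w)%O.
  apply/le_coordP => i; rewrite proj_point; case: ifP => [_|nMi].
    by move/le_coordP: levz; apply.
  by have := vM i; rewrite nMi => /eqP ->.
have ws : w \in s.
  rewrite mem_filter (le_trans lev levw) /=; apply/andP; split.
    by apply/forallP => i; rewrite proj_point; case: ifP.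
  apply: ideal_le Pz _; apply/le_coordP => i; rewrite proj_point.
  by case: ifP.
have -> : proj z k = proj w k by rewrite proj_point Mk.
apply/esym/(@eq_of_leq_sum _ xpredT (proj v) (proj w)) => //.
  by move=> i _; move/le_coordP: levw; apply.
by have /= := vmax w ws; lia.
Qed.

End Short.

Lemma exists_few_comparable : (0 < d)%N -> ~ in_coord_hyperplane P ->
  exists2 x, x \in P & (d * count (fun z => x >=< z)%O P <=
                        #|` P|%fset + (d * d + d + d * d.+1 ^ d))%N.
Proof.
move=> d_gt0 nhypP.
(* Each coordinate is positive somewhere on [P], so the ideal contains every unit vector. *)
have P1 j : axis j 1 \in P.
  have [|z Pz zj] := @exists_counterexample _ P (fun z => proj z j == 0%N).
    by move=> P0; apply: nhypP; exists j => z /P0/eqP.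
  by apply: ideal_le Pz _; apply: axis_le; rewrite lt0n.
have P0 j : axis j 0 \in P.
  by apply: ideal_le (P1 j) _; apply: axis_le.
pose M : pred 'I_d := [pred j | (side j).+1 < d]%N.
have [j small_j] := exists_small_comb M d_gt0.
have [Mj|nMj] := boolP (M j).
  have [|v Pv le_v] := comparable_short Mj (P1 j).
    by move=> k; rewrite /M /=; lia.
  exists v => //; rewrite -(leq_pmul2l d_gt0) mulnDr in le_v; lia.
exists (axis j (side j)); first exact: axis_side.
have le_c := comparable_axis_side (P0 j); have le_tq := side_mul_facet j.
have lt_side := side_le_comb (P0 j) nMj.
have le_dt : (d * side j <= #|` P|%fset)%N.
  by apply: leq_trans small_j; rewrite leq_mul2l lt_side orbT.
have le_d : (d <= (side j).+1)%N by move: nMj; rewrite /M /= -leqNgt.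
move: le_c; rewrite -(leq_pmul2l d_gt0) => /leq_trans; apply.
move: le_tq le_dt le_d; set q := count _ _ => le_tq le_dt le_d.
(* If [q <= d], the bound on [d * side j] suffices. Otherwise both truncated differences below are
   genuine, and expanding the product bounds [d * ((side j).+1 + q)] by
   [(side j).+1 * q + d * d]. *)
have [le_qd|/ltnW lt_dq] := leqP q d; first by nia.
by have : (0 <= ((side j).+1 - d) * (q - d))%N by []; nia.
Qed.

End Ideal.

(** * Passage to rational inequalities *)

Unset Implicit Arguments.

Theorem theorem1p9 (d : nat) (hd : (0 < d)%N) :
  (forall P : {fset Nd d}, convex P -> ~ chain P ->
     (max_incomp P)%:R >= (#|` P|%fset)%:R / 2 - 1 :> rat) /\
  (exists C : rat, forall P : {fset Nd d},
     ideal P -> ~ in_coord_hyperplane P ->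
     (max_incomp P)%:R > (1 - 1 / d%:R) * (#|` P|%fset)%:R - C).
Proof.
split=> [P cvxP nchainP|].
  have := convex_max_incomp cvxP nchainP.
  by rewrite -(ler_nat rat) natrD -muln2 natrM; lra.
(* [K] is the error term of [exists_few_comparable]; its successor makes the inequality strict. *)
pose K := (d * d + d + d * d.+1 ^ d)%N; exists (K.+1)%:R => P idP nhypP.
have [x Px le_x] := exists_few_comparable idP hd nhypP.
have le_inc := leq_max_incomp Px; have := incomp_count P x.
move: le_x le_inc; set c := count _ _; rewrite -/K.
set N := #|` P|%fset; set m := max_incomp P => le_x le_inc eqN.
have d_gt0 : 0 < d%:R :> rat by rewrite ltr0n.
have le_cN : (N <= m + c)%N by rewrite -eqN leq_add2r.
have lt_nat : (d * N < d * m + (N + d * K.+1))%N by nia.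
rewrite -(ltr_pM2l d_gt0).
have -> : d%:R * ((1 - 1 / d%:R) * N%:R - K.+1%:R) =
    d%:R * N%:R - N%:R - d%:R * K.+1%:R :> rat.
  by rewrite mulrBr mulrA mulrBr mulr1 div1r divff ?gt_eqF // mulrBl mul1r.
by move: lt_nat; rewrite -(ltr_nat rat) !(natrD, natrM); lra.
Qed.
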